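(* Let $a,b$ be nonnegative integers. For each $1\le i\le 2a+b+1$ there exists a polynomial $P_{a,b,i}(d,m,q)$ in $d,m,q$ with $\deg_m P_{a,b,i}\le 2a+b+1-i$ such that, for all integers $d\ge1$, $m\ge0$, $$\sum_{n\ge0}G^+_{d,m,a,b}(n)\,q^n=\sum_{i=1}^{2a+b+1}\frac{P_{a,b,i}(d,m,q)}{(1-q-dq^2)^i}.$$
   Context: For integers $d\ge1$, $n\ge0$ let $\mathcal{A}_{d,n}=\{(i,j):1\le i\le d,\ 1\le j\le n\}$. A subset $I\subseteq\mathcal{A}_{d,n}$ is nice if (1) $(i+1,j)\in I$ with $i\ge1$ implies $(i,j)\in I$, and (2) $(1,j)\in I$ with $1\le j\le n-1$ implies $(1,j+1)\notin I$. $\mathcal{B}^+_{d,n}$ is the set of nice subsets of $\mathcal{A}_{d,n}$ (for $n=0$ it is $\{\emptyset\}$). For $I$ nice, $|I|$ is its cardinality and $\sigma_m(I)=\sum_{(i,j)\in I}((i-1)m+j)$. Define $G^+_{d,m,a,b}(n)=\sum_{I\in\mathcal{B}^+_{d,n}}\sigma_m(I)^a|I|^b$ (with $0^0=1$). *)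

(* Defs.v *)
From HB Require Import structures.
From mathcomp Require Import all_boot all_order all_algebra.
From mathcomp Require Export mpoly.

Set Implicit Arguments.
Unset Strict Implicit.
Unset Printing Implicit Defensive.

Import GRing.Theory.
Local Open Scope ring_scope.

                                                                           
                                                                      
Definition nice (d n : nat) (I : {set 'I_d * 'I_n}) : bool :=
  [forall i : 'I_d, forall i' : 'I_d, forall j : 'I_n,
     (i' == i.+1 :> nat) && ((i', j) \in I) ==> ((i, j) \in I)] &&
  [forall i : 'I_d, forall j : 'I_n, forall j' : 'I_n,
     [&& i == 0%N :> nat, j' == j.+1 :> nat & (i, j) \in I]
       ==> ((i, j') \notin I)].

Definition Bplus (d n : nat) : {set {set 'I_d * 'I_n}} :=
  [set I : {set 'I_d * 'I_n} | nice I].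

                                                                
Definition sigma (d n m : nat) (I : {set 'I_d * 'I_n}) : nat :=
  (\sum_(x in I) (x.1 * m + x.2.+1))%N.

Definition Gplus (d m a b n : nat) : nat :=
  (\sum_(I in Bplus d n) sigma m I ^ a * #|I| ^ b)%N.

                                                                                
Section FormalPowerSeries.
Variable R : fieldType.
Implicit Types f g : nat -> R.

Definition fps_of_poly (p : {poly R}) : nat -> R := fun n => p`_n.

Definition fps_mul f g : nat -> R :=
  fun n => \sum_(k < n.+1) f k * g (n - k)%N.

                                        
                                                      
Fixpoint fps_inv_prefix f (n : nat) : seq R :=
  if n is k.+1 then
    let s := fps_inv_prefix f k in
    rcons s ((f 0%N)^-1 *
             ((k == 0%N)%:R - \sum_(j < k) f j.+1 * s`_(k - j.+1)))
  else [::].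

Definition fps_inv f : nat -> R := fun n => (fps_inv_prefix f n.+1)`_n.

Definition fps_div f g : nat -> R := fps_mul f (fps_inv g).

Lemma size_fps_inv_prefix f n : size (fps_inv_prefix f n) = n.
Proof. by elim: n => //= n IHn; rewrite size_rcons IHn. Qed.

Lemma nth_fps_inv_prefix f n k :
  (k < n)%N -> (fps_inv_prefix f n)`_k = fps_inv f k.
Proof.
elim: n => // n IHn; rewrite ltnS leq_eqVlt => /predU1P[-> // | lt_kn].
by rewrite /= nth_rcons size_fps_inv_prefix lt_kn IHn.
Qed.

Lemma fps_mulfV f :
  f 0%N != 0 -> forall n, fps_mul f (fps_inv f) n = (n == 0%N)%:R.
Proof.
move=> f0 n; rewrite /fps_mul big_ord_recl subn0.
rewrite {1}/fps_inv /= nth_rcons size_fps_inv_prefix ltnn eqxx mulVKf //.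
rewrite -[RHS]addr0 -addrA; congr (_ + _).
apply/eqP; rewrite addrC subr_eq0; apply/eqP/eq_bigr => j _.
by rewrite nth_fps_inv_prefix // ltn_subrL; case: n j => [[]|].
Qed.

End FormalPowerSeries.

                                                                   

                                                                       
Definition deg_in (i : 'I_3) (P : {mpoly rat[3]}) : nat :=
  (\max_(mon <- msupp P) mon i)%N.

                                                            
Definition eval_dm (P : {mpoly rat[3]}) (d m : nat) : {poly rat} :=
  mmap (@polyC rat) (tnth [tuple d%:R; m%:R; 'X]) P.

(* Main.v *)
(* A nice set is a sequence of column heights h_1, ..., h_n in {0, ..., d}, no
   two consecutive ones being nonzero. Let D = 1 - q - d q^2 and let s, c stand
   for sigma_m and the cardinality. Removing the first column, together with the
   empty second one when the first is nonempty, sends (s, c) to (s + c, c) or to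
   (s + 2c + w_h, c + h) with w_h = h + m * 'C(h, 2). Expanding the powers shows
   that D times the series of weight 2a+b is a polynomial plus a combination of
   series of strictly smaller weight: a factor w_h^k raises the degree in m by at
   most k and lowers the weight by 2k. The sums of w_h^k h^l over 1 <= h <= d are
   polynomials in d and m by Faulhaber, and induction on the weight concludes. *)
Require Import Defs.
From mathcomp Require Import all_boot all_order all_algebra.
From mathcomp Require Import zify ring.

Import GRing.Theory Num.Theory.
Local Open Scope ring_scope.

Set Implicit Arguments.
Unset Strict Implicit.
Unset Printing Implicit Defensive.

(** * Nice sets as sequences of column heights *)

Lemma big_tuple_cons (R : Type) (idx : R) (op : Monoid.com_law idx)
    (T : finType) (n : nat) (P : pred (seq T)) (F : seq T -> R) :
  \big[op/idx]_(t : n.+1.-tuple T | P t) F t =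
  \big[op/idx]_(x : T) \big[op/idx]_(t : n.-tuple T | P (x :: t)) F (x :: t).
Proof.
rewrite pair_big_dep /= (reindex (fun p : T * n.-tuple T => cons_tuple p.1 p.2)) //.
exists (fun t => (thead t, behead_tuple t)); last first.
  by move=> t _; rewrite [RHS]tuple_eta; apply: val_inj.
move=> [x t] _ /=.
by rewrite theadE; congr (_, _); apply: val_inj.
Qed.

(** Condition (2) read on column heights. The relation is not transitive: [sorted] tests adjacent
    heights only. *)
Definition sparse : rel nat := fun x y => (x == 0%N) || (y == 0%N).

(** This is [sigma] summed column by column: height h at the 0-based position j contributes the sum
    of i * m + j + 1 over i < h, that is, m * 'C(h, 2) + h * (j + 1). *)
Definition heights_weight (m : nat) (t : seq nat) : nat :=
  (\sum_(j < size t) (m * 'C(nth 0 t j, 2) + nth 0 t j * j.+1))%N.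

Definition heights_sum (d n m a b : nat) : nat :=
  (\sum_(t : n.-tuple 'I_d.+1 | sorted sparse (map val t))
     heights_weight m (map val t) ^ a * sumn (map val t) ^ b)%N.

(** Prepending a column moves every cell of [t] one place to the right, which adds the number of
    these cells, [sumn t]. *)
Lemma heights_weight_cons m x t :
  heights_weight m (x :: t) =
  (m * 'C(x, 2) + x + heights_weight m t + sumn t)%N.
Proof.
rewrite /heights_weight /= big_ord_recl /= muln1 -!addnA; congr (_ + (_ + _))%N.
rewrite sumnE (big_nth 0%N) big_mkord -big_split; apply: eq_bigr => j _ /=.
by rewrite /bump /= add1n [(_ * j.+2)%N]mulnS addnA addnAC.
Qed.

Section Heights.
Variables (d n : nat).
Implicit Types (I : {set 'I_d * 'I_n}) (t : n.-tuple 'I_d.+1).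

Definition stacks t : {set 'I_d * 'I_n} :=
  [set x : 'I_d * 'I_n | (x.1 < tnth t x.2)%N].

Definition column I (j : 'I_n) : {set 'I_d} := [set i | (i, j) \in I].

(** A column has at most d cells, so [inord] never falls back on its default value. *)
Definition heights I : n.-tuple 'I_d.+1 :=
  [tuple inord #|column I j| | j < n].

Lemma card_ord_lt (k : nat) : (k <= d)%N -> #|[set i : 'I_d | (i < k)%N]| = k.
Proof.
move=> kd; rewrite -sum1_card (eq_bigl (fun i : 'I_d => i < k)%N).
  by rewrite -(big_ord_widen d (fun=> 1%N)) // sum1_card card_ord.
by move=> i; rewrite inE.
Qed.

(** A set closed under predecessors is an initial segment, so its cardinal determines it: if i is in
    [A], so are all i' <= i and [A] has more than i elements; otherwise every element of [A] is
    below i. *)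
Lemma mem_initial (A : {set 'I_d}) (i : 'I_d) :
  (forall i i' : 'I_d, i' = i.+1 :> nat -> i' \in A -> i \in A) ->
  (i \in A) = (i < #|A|)%N.
Proof.
move=> stepA.
have downA k (i1 i2 : 'I_d) : (i2 = i1 + k :> nat)%N -> i2 \in A -> i1 \in A.
  elim: k i2 => [|k IHk] i2; first by rewrite addn0 => /val_inj->.
  rewrite addnS => Di2 Ai2.
  have lt_d : (i1 + k < d)%N by rewrite -Di2 ltnW.
  by apply: IHk (Ordinal lt_d) _ (stepA (Ordinal lt_d) i2 _ Ai2).
apply/idP/idP => [Ai | ].
  rewrite -[X in (X <= _)%N](card_ord_lt (ltn_ord i)).
  apply/subset_leq_card/subsetP=> i'.
  by rewrite inE ltnS => le_i; apply: (downA (i - i')%N) Ai; rewrite subnKC.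
apply: contraTT => Ai; rewrite -leqNgt.
rewrite -[X in (_ <= X)%N](card_ord_lt (ltnW (ltn_ord i))).
apply/subset_leq_card/subsetP=> i' Ai'; rewrite inE ltnNge.
by apply: contra Ai => le_i; apply: (downA (i' - i)%N) Ai'; rewrite subnKC.
Qed.

Lemma stacksK : cancel stacks heights.
Proof.
move=> t; apply: eq_from_tnth => j; rewrite tnth_mktuple.
apply: val_inj; rewrite /= inordK.
  rewrite -[RHS](@card_ord_lt (tnth t j)); last by rewrite -ltnS.
  by apply: eq_card => i; rewrite !inE.
by rewrite ltnS -[X in (_ <= X)%N]card_ord max_card.
Qed.

Lemma heightsK I : nice I -> stacks (heights I) = I.
Proof.
move=> /andP[/'forall_'forall_'forall_implyP down _].
apply/setP=> -[i j]; rewrite inE tnth_mktuple /= inordK; last first.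
  by rewrite ltnS -[X in (_ <= X)%N]card_ord max_card.
rewrite -mem_initial ?inE // => i1 i2 Di2; rewrite !inE => Ii2.
by apply: (down i1 i2 j); rewrite Di2 eqxx.
Qed.

Lemma nth_heights t (j : 'I_n) : nth 0%N (map val t) j = tnth t j :> nat.
Proof. by rewrite (nth_map ord0) ?size_tuple // (tnth_nth ord0). Qed.

(** Stacks satisfy condition (1) by construction. Condition (2) is read in the bottom row, of index
    0, which exists because d > 0; a column meets this row exactly when its height is nonzero. *)
Lemma nice_stacks t : (0 < d)%N -> nice (stacks t) = sorted sparse (map val t).
Proof.
move=> d_gt0; apply/idP/(sortedP 0%N).
  case/andP=> _ /'forall_'forall_'forall_implyP sep j.
  rewrite size_map size_tuple => lt_j.
  have /= := sep (Ordinal d_gt0) (Ordinal (ltnW lt_j)) (Ordinal lt_j).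
  rewrite !inE !eqxx /= -!nth_heights /= /sparse.
  by rewrite !lt0n; case: eqP => //= _ /(_ isT); rewrite negbK.
move=> sep; apply/andP; split; apply/'forall_'forall_'forall_implyP.
  by move=> i i' j /andP[/eqP Di']; rewrite !inE /= Di'; apply: ltnW.
move=> i j j' /and3P[/eqP i0 /eqP Dj']; rewrite !inE /= i0 -!nth_heights Dj'.
have := sep j; rewrite size_map size_tuple -Dj' ltn_ord => /(_ isT).
by rewrite /sparse !lt0n => /orP[]/eqP->.
Qed.

Lemma sum_stacks t (F : nat -> nat -> nat) :
  (\sum_(x in stacks t) F x.1 x.2 =
   \sum_(j < n) \sum_(i < tnth t j) F i j)%N.
Proof.
rewrite (eq_bigl (fun x : 'I_d * 'I_n => x.1 < tnth t x.2)%N); last first.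
  by move=> x; rewrite inE.
rewrite -(pair_big_dep xpredT (fun (i : 'I_d) (j : 'I_n) => i < tnth t j)%N
            (fun i j => F i j)) /= (exchange_big_dep xpredT) //=.
apply: eq_bigr => j _; rewrite [RHS](big_ord_widen d (fun i => F i j)) //.
by rewrite -ltnS.
Qed.

Lemma card_stacks t : #|stacks t| = sumn (map val t).
Proof.
rewrite -sum1_card (sum_stacks t (fun _ _ => 1%N)) sumnE big_map big_tuple.
by apply: eq_bigr => j _; rewrite sum1_card card_ord.
Qed.

Lemma sigma_stacks m t : sigma m (stacks t) = heights_weight m (map val t).
Proof.
rewrite /sigma (sum_stacks t (fun i j => i * m + j.+1)%N) /heights_weight.
rewrite size_map size_tuple; apply: eq_bigr => j _; rewrite nth_heights.
rewrite big_split sum_nat_const card_ord -big_distrl /= [(_ * m)%N]mulnC.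
by rewrite -bin2_sum big_mkord.
Qed.

End Heights.

Lemma Gplus_heights d m a b n :
  (0 < d)%N -> Gplus d m a b n = heights_sum d n m a b.
Proof.
move=> d_gt0; rewrite /Gplus (reindex_onto (@stacks d n) (@heights d n)) => [|I].
  apply: eq_big => [t|t _]; last by rewrite sigma_stacks card_stacks.
  by rewrite inE nice_stacks // stacksK eqxx andbT.
by rewrite inE; apply: heightsK.
Qed.

(** * Recurrence on the number of columns *)

Section HeightsRecurrence.
Variables (d m : nat).

(** The weight of a column of height h standing in the first position. *)
Definition column_weight (h : nat) : nat := (h + m * 'C(h, 2))%N.

Lemma heights_sum0 a b : heights_sum d 0 m a b = (0 ^ a * 0 ^ b)%N.
Proof.
rewrite /heights_sum (big_pred1 [tuple]); last by move=> t; rewrite !tuple0.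
by rewrite /heights_weight big_ord0.
Qed.

(** A nonempty sparse word starts with 0, or is a single nonzero letter, or starts with a nonzero
    letter followed by 0; what remains is an arbitrary sparse word. *)
Lemma sum_sparse_words n (f : seq nat -> nat) :
  (\sum_(t : n.+1.-tuple 'I_d.+1 | sorted sparse (map val t)) f (map val t) =
   \sum_(t : n.-tuple 'I_d.+1 | sorted sparse (map val t)) f (0%N :: map val t) +
   \sum_(h < d) (if n is n'.+1 then
      \sum_(t : n'.-tuple 'I_d.+1 | sorted sparse (map val t))
         f [:: h.+1, 0%N & map val t]
      else f [:: h.+1]))%N.
Proof.
rewrite (big_tuple_cons _ _ (fun t => sorted sparse (map val t))
           (fun t => f (map val t))) big_ord_recl; congr (_ + _)%N.
  by apply: eq_bigl => -[[|y t] Dt].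
apply: eq_bigr => h _; case: n => [|n].
  by rewrite (big_pred1 [tuple]) // => t; rewrite !tuple0.
rewrite (big_tuple_cons _ _ (fun t => sorted sparse (map val (_ :: t)))
           (fun t => f (map val (_ :: t)))) big_ord_recl /=.
(* Two leading nonzero heights are never sparse, so these terms are empty sums. *)
rewrite [X in (_ + X)%N]big1 ?addn0 => [|y _]; last by rewrite big_pred0.
by apply: eq_bigl => -[[|y t] Dt].
Qed.

(** Contribution of the words whose first column is empty: their weight is s + c, and (s + c)^a is
    expanded by the binomial formula. *)
Lemma sum_shifted_heights n a b :
  (\sum_(t : n.-tuple 'I_d.+1 | sorted sparse (map val t))
     (heights_weight m (map val t) + sumn (map val t)) ^ a * sumn (map val t) ^ b =
   \sum_(j < a.+1) 'C(a, j) * heights_sum d n m (a - j) (b + j))%N.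
Proof.
under eq_bigr => t _ do rewrite expnDn big_distrl /=.
rewrite exchange_big; apply: eq_bigr => j _; rewrite big_distrr.
by apply: eq_bigr => t _; rewrite expnD [(_ ^ b * _)%N]mulnC /= -!mulnA.
Qed.

Definition column_moment (k l : nat) : nat :=
  (\sum_(h < d) column_weight h.+1 ^ k * h.+1 ^ l)%N.

Lemma heights_sum1 a b :
  heights_sum d 1 m a b =
  (\sum_(j < a.+1) 'C(a, j) * heights_sum d 0 m (a - j) (b + j) +
   column_moment a b)%N.
Proof.
rewrite /heights_sum
  (sum_sparse_words _ (fun t => heights_weight m t ^ a * sumn t ^ b)%N).
rewrite -sum_shifted_heights; congr (_ + _)%N; apply: eq_bigr => x _.
  by rewrite heights_weight_cons muln0.
by rewrite heights_weight_cons /= /heights_weight big_ord0 !addn0 addnC.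
Qed.

(** For a nonempty first column, (s + 2c + w_h)^a (c + h)^b is expanded: k is the exponent of w_h, j
    that of 2c, and l that of h. Summing over h turns w_h^k h^l into [column_moment k l]. *)
Lemma heights_sumSS n a b :
  heights_sum d n.+2 m a b =
  (\sum_(j < a.+1) 'C(a, j) * heights_sum d n.+1 m (a - j) (b + j) +
   \sum_(k < a.+1) \sum_(j < (a - k).+1) \sum_(l < b.+1)
     'C(a, k) * 'C(a - k, j) * 'C(b, l) * 2 ^ j * column_moment k l *
     heights_sum d n m (a - k - j) (b - l + j))%N.
Proof.
rewrite {1}/heights_sum
  (sum_sparse_words _ (fun t => heights_weight m t ^ a * sumn t ^ b)%N).
rewrite -sum_shifted_heights; congr (_ + _)%N.
  by apply: eq_bigr => x _; rewrite heights_weight_cons muln0.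
pose s (t : n.-tuple 'I_d.+1) := heights_weight m (map val t).
pose c (t : n.-tuple 'I_d.+1) := sumn (map val t).
transitivity (\sum_(h < d) \sum_(t : n.-tuple 'I_d.+1 | sorted sparse (map val t))
  \sum_(k < a.+1) \sum_(j < (a - k).+1) \sum_(l < b.+1)
  'C(a, k) * 'C(a - k, j) * 'C(b, l) * 2 ^ j *
  (column_weight h.+1 ^ k * h.+1 ^ l) * (s t ^ (a - k - j) * c t ^ (b - l + j)))%N.
  apply: eq_bigr => h _; apply: eq_bigr => t _.
  rewrite !heights_weight_cons /= bin0n muln0 !add0n -/(s t) -/(c t).
  (* Two columns were removed, each shifting the rest by one place: hence 2c. *)
  have ->: (m * 'C(h.+1, 2) + h.+1 + (s t + c t) + c t =
            s t + 2 * c t + column_weight h.+1)%N.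
    rewrite /column_weight mul2n -addnn; lia.
  rewrite expnDn big_distrl; apply: eq_bigr => k _ /=.
  rewrite expnDn !(big_distrl, big_distrr) /=; apply: eq_bigr => j _.
  rewrite [(h.+1 + _)%N]addnC expnDn !(big_distrl, big_distrr) /=.
  apply: eq_bigr => l _; rewrite expnMn expnD; lia.
rewrite exchange_big.
under eq_bigr => t _ do rewrite exchange_big.
rewrite exchange_big; apply: eq_bigr => k _ /=.
under eq_bigr => t _ do rewrite exchange_big.
rewrite exchange_big; apply: eq_bigr => j _ /=.
under eq_bigr => t _ do rewrite exchange_big.
rewrite exchange_big; apply: eq_bigr => l _ /=.
rewrite big_distrr; apply: eq_bigr => t _ /=.
by rewrite -big_distrl -big_distrr.
Qed.

End HeightsRecurrence.

(** * Formal power series *)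

Section FormalPowerSeriesTheory.
Variable R : fieldType.
Implicit Types f g h u : nat -> R.

Lemma eq_fps_mul f f' g g' :
  f =1 f' -> g =1 g' -> fps_mul f g =1 fps_mul f' g'.
Proof. by move=> ff' gg' n; apply: eq_bigr => k _; rewrite ff' gg'. Qed.

(** A coefficient of a product depends on finitely many terms, so the ring laws of series can be
    imported from polynomials by truncation. *)
Lemma coef_mul_trunc N f g n : (n < N)%N ->
  ((\poly_(i < N) f i) * (\poly_(i < N) g i))`_n = fps_mul f g n.
Proof.
move=> ltnN; rewrite coefM; apply: eq_bigr => k _.
by rewrite !coef_poly !(leq_ltn_trans _ ltnN) ?leq_subr // -ltnS.
Qed.

Lemma fps_mulC f g : fps_mul f g =1 fps_mul g f.
Proof. by move=> n; rewrite -!(coef_mul_trunc _ _ (ltnSn n)) mulrC. Qed.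

Lemma fps_mulA f g h : fps_mul f (fps_mul g h) =1 fps_mul (fps_mul f g) h.
Proof.
move=> n; pose T (u : nat -> R) := \poly_(i < n.+1) u i.
(* The truncation of a product and the product of the truncations agree up to degree n, which is all
   that coefficient n sees. *)
have truncM u v (p : {poly R}) : (p * T (fps_mul u v))`_n = (p * (T u * T v))`_n.
  rewrite !coefM; apply: eq_bigr => k _; congr (_ * _).
  by rewrite coef_poly ltnS leq_subr coef_mul_trunc // ltnS leq_subr.
rewrite -!(coef_mul_trunc _ _ (ltnSn n)) truncM [in RHS]mulrC truncM.
by rewrite mulrA mulrC.
Qed.

Lemma fps_mul_poly (p q : {poly R}) :
  fps_mul (fps_of_poly p) (fps_of_poly q) =1 fps_of_poly (p * q).
Proof. by move=> n; rewrite /fps_of_poly coefM. Qed.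

Lemma fps_mul_sumr I (r : seq I) (P : pred I) f (F : I -> nat -> R) :
  fps_mul f (fun n => \sum_(i <- r | P i) F i n) =1
  fun n => \sum_(i <- r | P i) fps_mul f (F i) n.
Proof.
by move=> n; rewrite exchange_big; apply: eq_bigr => k _; rewrite mulr_sumr.
Qed.

Lemma fps_mulCl (c : R) f : fps_mul (fps_of_poly c%:P) f =1 fun n => c * f n.
Proof.
move=> n; rewrite /fps_mul big_ord_recl big1 => [|k _]; last first.
  by rewrite /fps_of_poly coefC mul0r.
by rewrite /fps_of_poly coefC addr0 subn0.
Qed.

Lemma fps_mulXl f n :
  fps_mul (fps_of_poly 'X) f n = if n is n'.+1 then f n' else 0.
Proof.
rewrite /fps_mul big_ord_recl {1}/fps_of_poly coefX mul0r add0r.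
case: n => [|n]; first by rewrite big_ord0.
rewrite big_ord_recl big1 => [|k _]; last by rewrite /fps_of_poly coefX mul0r.
by rewrite /fps_of_poly coefX mul1r addr0 subn1.
Qed.

Lemma fps_mulCXnl (c : R) s f n :
  fps_mul (fps_of_poly (c%:P * 'X^s)) f n = if (s <= n)%N then c * f (n - s)%N else 0.
Proof.
elim: s n => [|s IHs] n; first by rewrite expr0 mulr1 fps_mulCl subn0.
rewrite exprS mulrCA.
rewrite -(@eq_fps_mul _ _ f f (fps_mul_poly 'X (c%:P * 'X^s)) (frefl f)).
by rewrite -fps_mulA fps_mulXl; case: n => // n; rewrite IHs ltnS subSS.
Qed.

Lemma fps_mulDl f g h : fps_mul (fun n => g n + h n) f =1
  fun n => fps_mul g f n + fps_mul h f n.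
Proof. by move=> n; rewrite -big_split; apply: eq_bigr => k _; rewrite mulrDl. Qed.

Lemma fps_div0 f : fps_div (fps_of_poly 0) f =1 fun=> 0.
Proof. by move=> n; rewrite /fps_div -polyC0 fps_mulCl mul0r. Qed.

Lemma fps_divDl (p q : {poly R}) f :
  fps_div (fps_of_poly (p + q)) f =1
  fun n => fps_div (fps_of_poly p) f n + fps_div (fps_of_poly q) f n.
Proof.
move=> n; rewrite -fps_mulDl; apply: eq_fps_mul => // k.
by rewrite /fps_of_poly coefD.
Qed.

Lemma fps_divMl (p q : {poly R}) f :
  fps_div (fps_of_poly (p * q)) f =1
  fps_mul (fps_of_poly p) (fps_div (fps_of_poly q) f).
Proof.
move=> n; rewrite /fps_div fps_mulA; apply: eq_fps_mul => // k.
by rewrite fps_mul_poly.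
Qed.

Lemma fps_divK f g : g 0%N != 0 -> fps_mul (fps_div f g) g =1 f.
Proof.
move=> g0 n; rewrite -fps_mulA (@eq_fps_mul _ f _ (fps_of_poly 1%:P)) //.
  by rewrite fps_mulC fps_mulCl mul1r.
by move=> k; rewrite fps_mulC fps_mulfV // /fps_of_poly coefC; case: eqP.
Qed.

Lemma fps_mulIf g f h : g 0%N != 0 -> fps_mul f g =1 fps_mul h g -> f =1 h.
Proof.
move=> g0 fg n; have mulgK u : fps_mul (fps_mul u g) (fps_inv g) =1 u.
  move=> k; rewrite -fps_mulA (@eq_fps_mul _ u _ (fps_of_poly 1%:P)) //.
    by rewrite fps_mulC fps_mulCl mul1r.
  by move=> i; rewrite fps_mulfV // /fps_of_poly coefC; case: eqP.
by rewrite -(mulgK f) -(mulgK h); apply: eq_fps_mul.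
Qed.

Lemma fps_divE f g u : g 0%N != 0 -> fps_mul u g =1 f -> u =1 fps_div f g.
Proof.
by move=> g0 ug; apply: (fps_mulIf g0) => n; rewrite ug fps_divK.
Qed.

End FormalPowerSeriesTheory.

(** * Degrees and evaluation *)

Section DegreeBounds.
Variable i : 'I_3.
Implicit Types p q : {mpoly rat[3]}.

Lemma deg_inP p k :
  reflect {in msupp p, forall mon : 'X_{1..3}, (mon i <= k)%N} (deg_in i p <= k)%N.
Proof.
by apply: (iffP (bigmax_leqP_seq _ _ _ _)) => Hp mon; [move/Hp; apply | move=> /Hp].
Qed.

Lemma deg_inD p q k :
  (deg_in i p <= k)%N -> (deg_in i q <= k)%N -> (deg_in i (p + q) <= k)%N.
Proof.
move=> /deg_inP Hp /deg_inP Hq; apply/deg_inP => mon /msuppD_le.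
by rewrite mem_cat => /orP[/Hp | /Hq].
Qed.

Lemma deg_inM p q k l :
  (deg_in i p <= k)%N -> (deg_in i q <= l)%N -> (deg_in i (p * q) <= k + l)%N.
Proof.
move=> /deg_inP Hp /deg_inP Hq; apply/deg_inP => mon /msuppM_le.
by case/allpairsP=> -[m1 m2] [/= /Hp H1 /Hq H2 ->]; rewrite mnmDE leq_add.
Qed.

Lemma deg_inC c : deg_in i c%:MP = 0%N.
Proof.
apply/eqP; rewrite -leqn0; apply/deg_inP => mon; rewrite msuppC.
by case: ifP => // _; rewrite inE => /eqP->; rewrite mnm0E.
Qed.

Lemma deg_inX j : deg_in i 'X_j = (j == i).
Proof. by rewrite /deg_in msuppX big_seq1 mnmE. Qed.

Lemma deg_in0Xn p k : (deg_in i p <= 0)%N -> (deg_in i (p ^+ k) <= 0)%N.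
Proof.
move=> Hp; elim: k => [|k IHk]; first by rewrite expr0 deg_inC.
by rewrite exprS; apply: deg_inM Hp IHk.
Qed.

End DegreeBounds.

Section Evaluation.
Variables d m : nat.

Lemma eval_dmD p q : eval_dm (p + q) d m = eval_dm p d m + eval_dm q d m.
Proof. exact: mmapD. Qed.

Lemma eval_dmM p q : eval_dm (p * q) d m = eval_dm p d m * eval_dm q d m.
Proof. exact: rmorphM. Qed.

Lemma eval_dmXn p k : eval_dm (p ^+ k) d m = eval_dm p d m ^+ k.
Proof. exact: rmorphXn. Qed.

Lemma eval_dmC c : eval_dm c%:MP d m = c%:P.
Proof. exact: mmapC. Qed.

Lemma eval_dm0 : eval_dm 0 d m = 0.
Proof. exact: raddf0. Qed.

Lemma eval_dmX0 : eval_dm 'X_(0 : 'I_3) d m = (d%:R)%:P.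
Proof. by rewrite /eval_dm mmapX mmap1U rmorph_nat. Qed.

Lemma eval_dmX1 : eval_dm 'X_(1 : 'I_3) d m = (m%:R)%:P.
Proof. by rewrite /eval_dm mmapX mmap1U rmorph_nat. Qed.

Lemma eval_dmX2 : eval_dm 'X_(2 : 'I_3) d m = 'X.
Proof. by rewrite /eval_dm mmapX mmap1U. Qed.

End Evaluation.

(** * Polynomial families in d and m *)

(** A single polynomial must serve all d and m. The bound [e] concerns variable 1, which stands for
    m; variable 2, which stands for q, is kept as the indeterminate. *)
Definition mpoly_family (e : nat) (f : nat -> nat -> {poly rat}) :=
  exists2 c : {mpoly rat[3]}, (deg_in 1%R c <= e)%N & forall d m, eval_dm c d m = f d m.

Lemma mpoly_family_ext e f g :
  mpoly_family e f -> f =2 g -> mpoly_family e g.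
Proof. by case=> c deg_c Dc fg; exists c => // d m; rewrite Dc. Qed.

Lemma mpoly_family_leq e e' f : (e <= e')%N -> mpoly_family e f -> mpoly_family e' f.
Proof. by move=> le_e [c deg_c Dc]; exists c => //; apply: leq_trans le_e. Qed.

Lemma mpoly_familyC x e : mpoly_family e (fun _ _ => x%:P).
Proof. by exists x%:MP => [|d m]; rewrite ?deg_inC ?eval_dmC. Qed.

Lemma mpoly_familyD e f g :
  mpoly_family e f -> mpoly_family e g -> mpoly_family e (fun d m => f d m + g d m).
Proof.
case=> c deg_c Dc [c' deg_c' Dc']; exists (c + c'); first exact: deg_inD.
by move=> d m; rewrite eval_dmD Dc Dc'.
Qed.

Lemma mpoly_familyM e e' f g :
  mpoly_family e f -> mpoly_family e' g ->
  mpoly_family (e + e') (fun d m => f d m * g d m).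
Proof.
case=> c deg_c Dc [c' deg_c' Dc']; exists (c * c'); first exact: deg_inM.
by move=> d m; rewrite eval_dmM Dc Dc'.
Qed.

Lemma mpoly_familyZ e x f :
  mpoly_family e f -> mpoly_family e (fun d m => x%:P * f d m).
Proof. exact: (mpoly_familyM (mpoly_familyC x 0)). Qed.

Lemma mpoly_familyXn k : mpoly_family 0 (fun _ _ => 'X^k).
Proof.
exists ('X_(2 : 'I_3) ^+ k) => [|d m]; last by rewrite eval_dmXn eval_dmX2.
by apply: deg_in0Xn; rewrite deg_inX.
Qed.

Lemma mpoly_family_d k : mpoly_family 0 (fun d _ => (d%:R ^+ k)%:P).
Proof.
exists ('X_(0 : 'I_3) ^+ k) => [|d m]; last by rewrite eval_dmXn eval_dmX0 rmorphXn.
by apply: deg_in0Xn; rewrite deg_inX.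
Qed.

Lemma mpoly_family_m : mpoly_family 1 (fun _ m => (m%:R)%:P).
Proof. by exists 'X_(1 : 'I_3) => [|d m]; rewrite ?deg_inX ?eval_dmX1. Qed.

(** * Sums over the nonzero column heights *)

Definition summable (e : nat) (f : nat -> nat -> rat) :=
  mpoly_family e (fun d m => (\sum_(h < d) f h.+1 m)%:P).

Lemma summable_ext e f g :
  summable e f -> (forall h m, f h.+1 m = g h.+1 m) -> summable e g.
Proof.
move=> sum_f fg; apply: mpoly_family_ext sum_f _ => d m.
by congr _%:P; apply: eq_bigr.
Qed.

Lemma summableD e f g :
  summable e f -> summable e g -> summable e (fun h m => f h m + g h m).
Proof.
move=> sum_f sum_g; apply: mpoly_family_ext (mpoly_familyD sum_f sum_g) _ => d m.
by rewrite big_split polyCD.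
Qed.

Lemma summableZ e x f : summable e f -> summable e (fun h m => x * f h m).
Proof.
move=> sum_f; apply: mpoly_family_ext (mpoly_familyZ x sum_f) _ => d m.
by rewrite -mulr_sumr polyCM.
Qed.

Lemma summable_sum (I : Type) (r : seq I) e (f : I -> nat -> nat -> rat) :
  (forall i, summable e (f i)) -> summable e (fun h m => \sum_(i <- r) f i h m).
Proof.
move=> sum_f; elim: r => [|i r IHr].
  apply: mpoly_family_ext (mpoly_familyC 0 e) _ => d m.
  by rewrite big1 // => h _; rewrite big_nil.
by apply: summable_ext (summableD (sum_f i) IHr) _ => h m; rewrite big_cons.
Qed.

Lemma summable_mulm e f : summable e f -> summable e.+1 (fun h m => m%:R * f h m).
Proof.
move=> sum_f; apply: mpoly_family_ext (mpoly_familyM mpoly_family_m sum_f) _ => d m.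
by rewrite -mulr_sumr polyCM.
Qed.

(* Faulhaber: telescoping h^(n+1) - (h-1)^(n+1) expresses the sum of the n-th
   powers through the sums of lower powers. *)
Lemma summableXn n : summable 0 (fun h _ => h%:R ^+ n).
Proof.
have [N] := ubnP n; elim: N n => // N IHN n /ltnSE le_nN.
have sum_diff : summable 0 (fun h _ => h%:R ^+ n.+1 - (h.-1)%:R ^+ n.+1).
  apply: mpoly_family_ext (mpoly_family_d n.+1) _ => d m; congr _%:P.
  rewrite -(big_mkord xpredT (fun h => (h.+1)%:R ^+ n.+1 - h%:R ^+ n.+1)).
  by rewrite telescope_sumr // expr0n subr0.
(* The terms of index at least 2 in the expansion of (h - 1)^(n+1): added to the difference, they
   leave (n + 1) h^n. *)
have sum_low : summable 0 (fun h _ =>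
    \sum_(i < n) ((-1) ^+ i * 'C(n.+1, i.+2)%:R) * h%:R ^+ (n - i.+1)).
  apply: summable_sum => i; apply: summableZ; apply: IHN.
  by rewrite (leq_trans _ le_nN) // ltn_subrL (leq_ltn_trans _ (ltn_ord i)).
apply: summable_ext (summableZ (n.+1)%:R^-1 (summableD sum_diff sum_low)) _ => h _ /=.
have ->: h%:R = (h.+1)%:R - 1 :> rat by rewrite -natr1 addrK.
rewrite exprBn !big_ord_recl /= !expr0 expr1 !mul1r !expr1n !mulr1.
rewrite subn0 bin0 subn1 bin1.
apply: (mulfI (_ : (n.+1)%:R != 0)); first by rewrite pnatr_eq0.
rewrite mulVKf ?pnatr_eq0 //.
set S := \sum_(i < n) _; set S' := \sum_(i < n) _.
suff ->: S' = S by rewrite -mulr_natl; ring.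
by apply: eq_bigr => i _;
  rewrite /bump /= !add1n expr1n mulr1 subSS !exprS -mulr_natr; ring.
Qed.

(** Over the rationals the binomial coefficient becomes (h^2 - h) / 2, which shows w_h as a
    polynomial in h and m, of degree at most 1 in m. *)
Lemma column_weightE m h :
  (column_weight m h)%:R = h%:R + m%:R * (2^-1 * (h%:R ^+ 2 - h%:R)) :> rat.
Proof.
rewrite /column_weight natrD natrM; congr (_ + _ * _).
apply: (mulfI (_ : 2%:R != 0)); first by rewrite pnatr_eq0.
rewrite mulVKf ?pnatr_eq0 // -natrM.
case: h => [|h]; first by rewrite bin0n muln0 expr0n subrr.
by rewrite -mul_bin_diag bin1 natrM -natr1; ring.
Qed.

(** One more factor w_h = h + m (h^2 - h) / 2 costs at most one degree in m and raises the exponent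
    of h by 1 or 2, so the induction on k keeps l general. *)
Lemma summable_weight k l :
  summable k (fun h m => (column_weight m h)%:R ^+ k * h%:R ^+ l).
Proof.
elim: k l => [|k IHk] l.
  by apply: summable_ext (summableXn l) _ => h m; rewrite mul1r.
have half j := summableZ 2^-1 (IHk j).
have halfB := summableD (half l.+2) (summableZ (-1) (half l.+1)).
have lower : summable k.+1 _ := mpoly_family_leq (leqnSn k) (IHk l.+1).
apply: summable_ext (summableD lower (summable_mulm halfB)) _ => h m.
rewrite [in RHS]exprS; set x := _ ^+ k; rewrite column_weightE.
by move: (h.+1%:R : rat) (x : rat) => y z; rewrite !exprS; ring.
Qed.

Lemma mpoly_family_moment k l :
  mpoly_family k (fun d m => ((column_moment d m k l)%:R)%:P).
Proof.
apply: mpoly_family_ext (summable_weight k l) _ => d m; congr _%:P.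
by rewrite natr_sum; apply: eq_bigr => h _; rewrite natrM !natrX.
Qed.

(** * Series with poles bounded by powers of 1 - q - d q^2 *)

Definition denom (d : nat) : {poly rat} := 1 - 'X - d%:R *: 'X^2.

Lemma coef0_denomX d i : fps_of_poly (denom d ^+ i) 0%N != 0.
Proof.
rewrite /fps_of_poly -horner_coef0 !hornerE /= mulr0 subr0 expr1n.
exact: oner_neq0.
Qed.

(** Pole order plus degree in m is at most w. Index 0 allows a polynomial part, as D times a series
    has; division by D then shifts all indices by one. *)
Definition pole_bounded (w : nat) (F : nat -> nat -> nat -> rat) :=
  exists2 P : nat -> {mpoly rat[3]},
    forall i, (i <= w)%N -> (deg_in 1%R (P i) <= w - i)%N &
    forall d m, (0 < d)%N -> forall n, F d m n =
      \sum_(i < w.+1) fps_div (fps_of_poly (eval_dm (P i) d m))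
                              (fps_of_poly (denom d ^+ i)) n.

Lemma pole_bounded_ext w F F' :
  pole_bounded w F -> (forall d m n, (0 < d)%N -> F d m n = F' d m n) ->
  pole_bounded w F'.
Proof. by case=> P degP DP FF'; exists P => // d m d_gt0 n; rewrite -FF' // DP. Qed.

Lemma pole_boundedD w F F' :
  pole_bounded w F -> pole_bounded w F' ->
  pole_bounded w (fun d m n => F d m n + F' d m n).
Proof.
case=> P degP DP [P' degP' DP']; exists (fun i => P i + P' i) => [i le_i|d m d_gt0 n].
  by apply: deg_inD; [apply: degP | apply: degP'].
rewrite DP // DP' // -big_split; apply: eq_bigr => i _ /=.
by rewrite eval_dmD fps_divDl.
Qed.

Lemma pole_bounded0 w : pole_bounded w (fun _ _ _ => 0).
Proof.
exists (fun=> 0) => [i _|d m _ n]; first by rewrite -mpolyC0 deg_inC.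
by rewrite big1 // => i _; rewrite eval_dm0 fps_div0.
Qed.

Lemma pole_bounded_sum w n F :
  (forall i : 'I_n, pole_bounded w (F i)) ->
  pole_bounded w (fun d m k => \sum_(i < n) F i d m k).
Proof.
elim: n F => [|n IHn] F HF.
  by apply: pole_bounded_ext (pole_bounded0 w) _ => d m k _; rewrite big_ord0.
apply: pole_bounded_ext (pole_boundedD (HF ord0) (IHn _ (fun i => HF (lift ord0 i)))) _.
by move=> d m k _; rewrite big_ord_recl.
Qed.

Lemma pole_bounded_leq w w' F : (w <= w')%N -> pole_bounded w F -> pole_bounded w' F.
Proof.
move=> le_w [P degP DP].
exists (fun i => if (i <= w)%N then P i else 0) => [i _|d m d_gt0 n].
  case: ifP => le_i; last by rewrite -mpolyC0 deg_inC.
  by apply: leq_trans (degP _ le_i) _; rewrite leq_sub2r.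
rewrite DP // (big_ord_widen w'.+1 (fun i => fps_div (fps_of_poly (eval_dm (P i) d m))
  (fps_of_poly (denom d ^+ i)) n)) // big_mkcond; apply: eq_bigr => i _ /=.
by rewrite ltnS; case: ifP => // _; rewrite eval_dm0 fps_div0.
Qed.

Lemma pole_bounded_poly e f :
  mpoly_family e f -> pole_bounded e (fun d m n => (f d m)`_n).
Proof.
case=> c deg_c Dc; exists (fun i => if i == 0%N then c else 0) => [i _|d m _ n].
  by case: eqP => [->|_]; [rewrite subn0 | rewrite -mpolyC0 deg_inC].
rewrite big_ord_recl /= big1 ?addr0 => [|i _]; last by rewrite eval_dm0 fps_div0.
rewrite Dc; apply: fps_divE => [|k]; first exact: coef0_denomX.
by rewrite (fps_mul_poly (f d m)) mulr1.
Qed.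

(** Multiplying the numerators by f keeps the pole orders and raises each degree bound by e, from w
    - i to e + w - i. *)
Lemma pole_boundedM e w f F :
  mpoly_family e f -> pole_bounded w F ->
  pole_bounded (e + w) (fun d m => fps_mul (fps_of_poly (f d m)) (F d m)).
Proof.
case=> c deg_c Dc [P degP DP]; apply: pole_bounded_ext; last first.
  move=> d m n d_gt0; symmetry.
  have -> := @eq_fps_mul _ (fps_of_poly (f d m)) _ _ _ (frefl _) (DP d m d_gt0) n.
  by rewrite fps_mul_sumr.
rewrite /=; pose Q i := if (i <= w)%N then c * P i else 0.
exists Q => [i _|d m d_gt0 n]; rewrite /Q.
  case: ifP => le_i; last by rewrite -mpolyC0 deg_inC.
  by rewrite -addnBA //; apply: deg_inM (degP _ le_i).
rewrite (big_ord_widen (e + w).+1 (fun i => fps_mul (fps_of_poly (f d m))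
  (fps_div (fps_of_poly (eval_dm (P i) d m)) (fps_of_poly (denom d ^+ i))) n)); last first.
  by rewrite ltnS leq_addl.
rewrite big_mkcond; apply: eq_bigr => i _; rewrite ltnS.
by case: ifP => _; rewrite ?eval_dm0 ?fps_div0 // eval_dmM fps_divMl Dc.
Qed.

(** Dividing by D turns D^i into D^(i+1). The numerator over D^i is therefore the former one of
    index i - 1, with bound w - (i - 1), and no polynomial part remains. *)
Lemma pole_bounded_denom w F :
  pole_bounded w (fun d m => fps_mul (fps_of_poly (denom d)) (F d m)) ->
  exists P : nat -> {mpoly rat[3]},
    (forall i, (1 <= i <= w.+1)%N -> (deg_in 1%R (P i) <= w.+1 - i)%N) /\
    (forall d m, (1 <= d)%N -> forall n, F d m n =
      \sum_(1 <= i < w.+2) fps_div (fps_of_poly (eval_dm (P i) d m))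
                              (fps_of_poly (denom d ^+ i)) n).
Proof.
case=> P degP DP; exists (fun i => P i.-1); split=> [[|i] // le_i|d m d_gt0].
  by rewrite subSS degP.
have denom0 := coef0_denomX d 1; rewrite expr1 in denom0.
apply: (fps_mulIf denom0) => n; rewrite fps_mulC DP //.
rewrite fps_mulC fps_mul_sumr big_add1 big_mkord; apply: eq_bigr => i _ /=.
symmetry; apply: fps_divE => [|k]; first exact: coef0_denomX.
rewrite fps_mulC fps_mulA.
rewrite (@eq_fps_mul _ _ _ _ _ (fps_mul_poly (denom d ^+ i) (denom d)) (frefl _)).
by rewrite -exprSr fps_mulC fps_divK // coef0_denomX.
Qed.

(** The same division with a zero numerator put back at index 0, so that the result can be used
    again in the induction. *)
Lemma pole_bounded_div w F :
  pole_bounded w (fun d m => fps_mul (fps_of_poly (denom d)) (F d m)) ->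
  pole_bounded w.+1 F.
Proof.
case/pole_bounded_denom=> P [degP DP].
exists (fun i => if i == 0%N then 0 else P i) => [[|i] le_i|d m d_gt0 n].
- by rewrite -mpolyC0 deg_inC.
- exact: degP.
by rewrite big_ord_recl eval_dm0 fps_div0 add0r DP // big_add1 big_mkord.
Qed.

Lemma denom_mul d (F : nat -> rat) n :
  fps_mul (fps_of_poly (denom d)) F n =
  F n - (if n is n'.+1 then F n' else 0) - (if n is n'.+2 then d%:R * F n' else 0).
Proof.
have ->: denom d = 1%:P * 'X^0 + ((-1)%:P * 'X^1 + (- d%:R)%:P * 'X^2).
  by rewrite /denom -mul_polyC !polyCN expr1 expr0 mulr1 !mulNr mul1r addrA.
rewrite (@eq_fps_mul _ _ (fun n => fps_of_poly (1%:P * 'X^0) n +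
  (fps_of_poly ((-1)%:P * 'X^1) n + fps_of_poly ((- d%:R)%:P * 'X^2) n)) F F) //; last first.
  by move=> k; rewrite /fps_of_poly !coefD.
rewrite !fps_mulDl !fps_mulCXnl /= mul1r subn0 addrA.
by case: n => [|[|n]] /=; rewrite ?subSS ?subn0 ?mulN1r ?mulNr ?subr0 ?addr0.
Qed.

(** * Functional equation of the series and induction on the weight *)

Definition heights_series (a b d m n : nat) : rat := (heights_sum d n m a b)%:R.

(** Isolates k = j = l = 0, the term of the recurrence in which the series itself reappears. *)
Lemma sum3_first (V : nmodType) (a b : nat) (n : nat -> nat)
    (T : nat -> nat -> nat -> V) :
  \sum_(k < a.+1) \sum_(j < (n k).+1) \sum_(l < b.+1) T k j l =
  T 0%N 0%N 0%N + \sum_(k < a.+1) \sum_(j < (n k).+1) \sum_(l < b.+1)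
    if (k + j + l == 0)%N then 0 else T k j l.
Proof.
rewrite big_ord_recl [in RHS]big_ord_recl addrA; congr (_ + _).
rewrite big_ord_recl [in RHS]big_ord_recl addrA; congr (_ + _).
by rewrite big_ord_recl [in RHS]big_ord_recl add0r.
Qed.

(** In D = 1 - q - d q^2, the part -q cancels the term j = 0 of the empty first column, and -d q^2
    cancels the term k = j = l = 0 of the nonempty one. All remaining series have smaller weight 2a
    + b. *)
Lemma heights_series_recurrence a b d m n :
  fps_mul (fps_of_poly (denom d)) (heights_series a b d m) n =
  (((a + b == 0)%N%:R)%:P + (column_moment d m a b)%:R%:P * 'X^1)`_n +
  (\sum_(j < a) fps_mul (fps_of_poly (('C(a, j.+1)%:R)%:P * 'X^1))
                  (heights_series (a - j.+1) (b + j.+1) d m) n +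
   \sum_(k < a.+1) \sum_(j < (a - k).+1) \sum_(l < b.+1)
     if (k + j + l == 0)%N then 0 else
     fps_mul (fps_of_poly
       ((('C(a, k) * 'C(a - k, j) * 'C(b, l) * 2 ^ j)%:R)%:P *
        (column_moment d m k l)%:R%:P * 'X^2))
       (heights_series (a - k - j) (b - l + j) d m) n).
Proof.
rewrite denom_mul coefD coefMXn !coefC.
under eq_bigr => j _ do rewrite fps_mulCXnl.
under [X in _ + (_ + X)]eq_bigr => k _.
  under eq_bigr => j _ do [under eq_bigr => l _ do rewrite -polyCM fps_mulCXnl].
  over.
(* Coefficients 0 and 1 carry the polynomial part; from 2 on, the two-step recurrence applies. *)
case: n => [|[|n]] /=.
- rewrite [X in _ + (X + _)]big1 // big1 => [|k _]; last first.
    by rewrite big1 // => j _; rewrite big1 // => l _; rewrite if_same.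
  rewrite /heights_series heights_sum0 !addr0 ?subr0 addn_eq0.
  by case: a b => [|a] [|b]; rewrite ?expn0 ?exp0n ?muln0.
- rewrite [X in _ = _ + (_ + X)]big1 => [|k _]; last first.
    by rewrite big1 // => j _; rewrite big1 // => l _; rewrite if_same.
  rewrite /heights_series heights_sum1 big_ord_recl bin0 mul1n subn0 addn0 !natrD.
  set S := \sum_(i < a) _; set S' := \sum_(j < a) _.
  have ->: S' = S%:R by rewrite natr_sum; apply: eq_bigr => j _; rewrite natrM subnn.
  ring.
rewrite /heights_series heights_sumSS natrD !subSS !subn0 big_ord_recl bin0 mul1n.
rewrite subn0 addn0 natrD.
rewrite (sum3_first a b (fun k => (a - k)%N) (fun k j l =>
  'C(a, k) * 'C(a - k, j) * 'C(b, l) * 2 ^ j * column_moment d m k l *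
  heights_sum d n m (a - k - j) (b - l + j))%N) natrD.
set S := (\sum_(i < a) _)%N; set S3 := (\sum_(k < a.+1) _)%N.
set S' := \sum_(j < a) _; set S3' := \sum_(k < a.+1) _.
have ->: S' = S%:R by rewrite natr_sum; apply: eq_bigr => j _; rewrite natrM.
have ->: S3' = S3%:R.
  rewrite natr_sum; apply: eq_bigr => k _; rewrite natr_sum; apply: eq_bigr => j _.
  by rewrite natr_sum; apply: eq_bigr => l _; case: ifP => // _; rewrite -!natrM.
(* This value makes the isolated term cancel against -d q^2. *)
have ->: column_moment d m 0 0 = d.
  by rewrite /column_moment (eq_bigr (fun=> 1%N)) // sum1_card card_ord.
rewrite !subn0 addn0 !bin0 !mul1n natrM; ring.
Qed.

Lemma pole_bounded_heights a b :
  pole_bounded (2 * a + b)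
    (fun d m => fps_mul (fps_of_poly (denom d)) (heights_series a b d m)).
Proof.
have [N] := ubnP (2 * a + b)%N; elim: N a b => // N IHN a b /ltnSE le_N.
(* A series of smaller weight w' is bounded at w' + 1, after division by D, hence at every w >
   w'. *)
have IH a' b' w : (2 * a' + b' < 2 * a + b)%N -> (2 * a' + b' < w)%N ->
    pole_bounded w (heights_series a' b').
  move=> lt_ab lt_w; apply: pole_bounded_leq lt_w _; apply: pole_bounded_div.
  by apply: IHN; apply: leq_trans lt_ab le_N.
(* The series to be bounded is left open and is filled in by the functional equation. *)
apply: pole_bounded_ext; last first.
  by move=> d m n _; rewrite heights_series_recurrence; reflexivity.
rewrite /=; apply: pole_boundedD; last apply: pole_boundedD.
- apply: (@pole_bounded_leq a); first by lia.
  apply: pole_bounded_poly; apply: mpoly_familyD; first exact: mpoly_familyC.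
  by rewrite -[X in mpoly_family X]addn0;
  exact: mpoly_familyM (mpoly_family_moment _ _) (mpoly_familyXn 1).
- apply: pole_bounded_sum => j.
  apply: (pole_boundedM (mpoly_familyZ _ (mpoly_familyXn 1)) (F := heights_series _ _)).
  by have lt_j := ltn_ord j; apply: IH; lia.
apply: pole_bounded_sum => k; apply: pole_bounded_sum => j.
apply: pole_bounded_sum => l.
case: eqP => [_|nz_kjl]; first exact: pole_bounded0.
have := (ltn_ord k, ltn_ord j, ltn_ord l) => -[[lt_k lt_j] lt_l].
(* The moment uses degree k in m, which leaves 2a + b - k for the series. Its weight is 2a + b - 2k
   - j - l, strictly smaller because k + j + l > 0. *)
apply: (@pole_bounded_leq (k + (2 * a + b - k))); first by lia.
apply: pole_boundedM; last by apply: IH; lia.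
rewrite -[X in mpoly_family X]addn0.
apply: mpoly_familyM (mpoly_familyXn 2).
by apply: mpoly_familyZ; apply: mpoly_family_moment.
Qed.

Theorem theorem4p1 (a b : nat) :
  exists P : nat -> {mpoly rat[3]},
    (forall i : nat, (1 <= i <= 2 * a + b + 1)%N ->
       (deg_in 1%R (P i) <= 2 * a + b + 1 - i)%N) /\
    (forall d m : nat, (1 <= d)%N ->
       forall n : nat,
         (Gplus d m a b n)%:R =
         \sum_(1 <= i < (2 * a + b + 1).+1)
            fps_div (fps_of_poly (eval_dm (P i) d m))
                    (fps_of_poly ((1 - 'X - d%:R *: 'X^2) ^+ i)) n).
Proof.
rewrite addn1; have [P [degP DP]] := pole_bounded_denom (pole_bounded_heights a b).
exists P; split=> // d m d_gt0 n.
by rewrite Gplus_heights // -[LHS]/(heights_series a b d m n) DP.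
Qed.
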